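(* If $\lambda(z)|dz|$ is an SK-metric on $\mathbb{D}^*$ with a singularity of order $\alpha\in(0,1)$ at the origin, then the upper limit $$l:=\limsup_{z\to0}|z|^{\alpha}\lambda(z)$$ satisfies $l\leq1-\alpha$.
   Context: $\mathbb{D}^*=\{z\in\mathbb{C}:0<|z|<1\}$. A conformal metric $\lambda(z)|dz|$ on a domain $G\subseteq\mathbb{C}$ is given by a positive, upper semi-continuous density $\lambda:G\to(0,+\infty)$. Its (generalized) Gaussian curvature is $$\kappa_\lambda(z)=-\frac{1}{\lambda(z)^2}\liminf_{r\to0}\frac{4}{r^2}\left(\frac{1}{2\pi}\int_0^{2\pi}\log\lambda(z+re^{it})\,dt-\log\lambda(z)\right).$$ The metric is an SK-metric if $\kappa_\lambda(z)\leq-4$ at every $z\in G$. A conformal metric on $\mathbb{D}^*$ has a singularity of order $\alpha<1$ at the origin if $\log\lambda(z)=-\alpha\log|z|+O(1)$ as $z\to0$. *)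

(* Defs.v *)
From HB Require Import structures.
From mathcomp Require Import all_boot all_order all_algebra.
From mathcomp Require Import complex.
From mathcomp Require Import all_classical all_reals all_analysis.

Set Implicit Arguments.
Unset Strict Implicit.
Unset Printing Implicit Defensive.

Import Order.TTheory GRing.Theory Num.Theory.
Import numFieldNormedType.Exports.
Export Normc.

Local Open Scope classical_set_scope.
Local Open Scope ring_scope.
Local Open Scope complex_scope.

(* The norm topology of the complex numbers; the library only provides it for
   a variable of type numClosedFieldType, not for the concrete type R[i]. *)
HB.instance Definition _ (R : rcfType) :=
  NormedModule.copy R[i] (R[i]^o : normedModType R[i]).

Definition punctured_disc (R : realType) : set R[i] :=
  [set z | 0 < normc z < 1].
Arguments punctured_disc : clear implicits.

(* Densities are total functions on R[i]; every notion below only depends on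
   their values on the open set G. *)

Definition upper_semicontinuous_on (R : realType) (G : set R[i])
    (f : R[i] -> R) : Prop :=
  forall z, G z -> forall a, f z < a ->
    \forall w \near within G (nbhs z), f w < a.

Definition conformal_metric (R : realType) (G : set R[i])
    (lambda : R[i] -> R) : Prop :=
  (forall z, G z -> 0 < lambda z) /\ upper_semicontinuous_on G lambda.

(* Upper semi-continuity bounds ln lambda from above on circles inside G, so
   for those the integral makes sense in [-oo, +oo[; only small r matter in the
   curvature. *)
Definition log_circle_mean (R : realType) (lambda : R[i] -> R) (z : R[i])
    (r : R) : \bar R :=
  (((2 * pi)^-1)%:E *
   \int[@lebesgue_measure R]_(t in `[0%R, (2 * pi)%R])
     (ln (lambda (z + (r * cos t +i* (r * sin t)))))%:E)%E.

Definition curvature (R : realType) (lambda : R[i] -> R) (z : R[i]) : \bar R :=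
  (- ((lambda z ^+ 2)^-1)%:E *
   limf_einf (fun r : R =>
     (4 / r ^+ 2)%:E * (log_circle_mean lambda z r - (ln (lambda z))%:E))
     0%R^'+)%E.

Definition SK_metric (R : realType) (G : set R[i]) (lambda : R[i] -> R) : Prop :=
  conformal_metric G lambda /\
  forall z, G z -> (curvature lambda z <= (- 4%R)%:E)%E.

Definition singularity_of_order (R : realType) (lambda : R[i] -> R)
    (alpha : R) : Prop :=
  alpha < 1 /\
  ((fun z => ln (lambda z)) =
   (fun z => - alpha * ln (normc z)) +O_ ((0 : R[i])^') (fun=> 1 : R)).

(* Main.v *)
(** The metric on the disc of radius [R] with density
      mu(z) = b R^b |z|^(b-1) / (R^(2b) - |z|^(2b)),   0 < b < 1 - alpha,
    has constant curvature -4, blows up at |z| = R, and has order 1 - b > alpha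
    at the origin.  Hence lambda/mu tends to 0 at both boundary components of
    the punctured disc of radius [R]; were it larger than 1 somewhere, it would
    attain an interior maximum z0 with lambda(z0) > mu(z0).  There ln lambda -
    ln mu is maximal, so the Laplacian of ln lambda is at most that of ln mu,
    4 mu(z0)^2 < 4 lambda(z0)^2, contradicting the curvature bound (Ahlfors).
    Letting R -> 1 and b -> 1 - alpha gives
      |z|^alpha lambda(z) (1 - |z|^(2(1-alpha))) <= 1 - alpha.
    As mu is radial, the circle means of ln mu are controlled by the one-variable
    Taylor formula in s = |z|^2, the Laplacian of f(|z|^2) being 4 (f' + s f''). *)
Require Import Defs.
From mathcomp Require Import all_boot all_order all_algebra.
From mathcomp Require Import complex.
From mathcomp Require Import all_classical all_reals all_analysis.
From mathcomp Require Import ring lra.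

Set Implicit Arguments.
Unset Strict Implicit.
Unset Printing Implicit Defensive.

Import Order.TTheory GRing.Theory Num.Theory.
Import numFieldNormedType.Exports.

Local Open Scope classical_set_scope.
Local Open Scope ring_scope.
Local Open Scope complex_scope.

(** * Comparison of integrals and of upper and lower limits *)

(* [le_integral] asks for integrability, but the mean of [ln lambda] may be -oo;
   since the integral of a nonnegative function is a supremum over simple
   functions, not even measurability is needed. *)
Lemma le_integral_pointwise d (T : measurableType d) (R : realType)
    (mu : {measure set T -> \bar R}) (D : set T) (f g : T -> \bar R) :
  (forall x, D x -> (f x <= g x)%E) ->
  (\int[mu]_(x in D) f x <= \int[mu]_(x in D) g x)%E.
Proof.
move=> fg.
have restrict_le x : (((f \_ D) x) <= ((g \_ D) x))%E.
  by rewrite !patchE; case: ifPn => [/set_mem/fg|].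
rewrite /integral; apply: leeB; apply: ge_ereal_sup => _ [h /= hle <-];
  apply: ereal_sup_ubound; exists h => //= x; apply: le_trans (hle x) _.
- by rewrite !funeposE; apply: le_max2 => //.
- by rewrite !funenegE; apply: le_max2 => //; rewrite leeN2.
Qed.

Lemma limf_einf_le (T : choiceType) (X : filteredType T) (R : realType)
    (F : set_system X) (f : X -> \bar R) (c : \bar R) :
  ProperFilter F -> F [set x | (f x <= c)%E] ->
  (limf_einf f F <= c)%E.
Proof.
move=> FF fc; rewrite limf_einfE; apply: ge_ereal_sup => _ [V FV <-].
have [x [Vx fxc]] := filter_ex (filterI FV fc).
by apply: le_trans fxc; apply: ereal_inf_lbound; exists x.
Qed.

Lemma limf_esup_le (T : choiceType) (X : filteredType T) (R : realType)
    (F : set_system X) (f : X -> \bar R) (c : \bar R) :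
  F [set x | (f x <= c)%E] -> (limf_esup f F <= c)%E.
Proof.
move=> fc; rewrite limf_esupE.
apply: (@le_trans _ _ (ereal_sup (f @` [set x | (f x <= c)%E]))).
  by apply: ereal_inf_lbound; exists [set x | (f x <= c)%E].
by apply: ge_ereal_sup => _ [x /= ? <-].
Qed.

(** * Modulus, topology and compactness in the complex plane *)

Lemma sqr_normc_ReIm (R : rcfType) (z : R[i]) :
  normc z ^+ 2 = complex.Re z ^+ 2 + complex.Im z ^+ 2.
Proof. by case: z => x y /=; rewrite sqr_sqrtr// addr_ge0 ?sqr_ge0. Qed.

Lemma normc_ge0 (R : rcfType) (z : R[i]) : 0 <= normc z.
Proof. by case: z => x y; exact: sqrtr_ge0. Qed.

Lemma normc_gt0 (R : rcfType) (z : R[i]) : (0 < normc z) = (z != 0).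
Proof.
rewrite lt_def normc_ge0 andbT; congr (~~ _).
by apply/eqP/eqP => [/eq0_normc|->]; [|exact: normc0].
Qed.

Lemma normrE_normc (R : rcfType) (z : R[i]) : `|z| = (normc z)%:C.
Proof. by case: z. Qed.

(** Balls in [R[i]] have radii in [R[i]] itself; a positive one has zero imaginary part, so its real
    part can serve as a real radius. *)
Lemma nbhs_normcP (R : realType) (z : R[i]) (A : set R[i]) :
  nbhs z A <-> exists2 e : R, 0 < e & forall w, normc (w - z) < e -> A w.
Proof.
split=> [/nbhs_ballP[e /= e0 zA]|[e e0 zA]].
  have eE : e = (complex.Re e)%:C.
    by move: e0; rewrite ltcE; case: e {zA} => a b /= /andP[/eqP -> _].
  exists (complex.Re e); first by move: e0; rewrite ltcE => /andP[].
  by move=> w wz; apply: zA; rewrite -ball_normE/= distrC eE normrE_normc ltcR.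
apply/nbhs_ballP; exists e%:C; first by rewrite /= ltcE /= eqxx.
move=> w; rewrite -ball_normE/= distrC normrE_normc ltcR; exact: zA.
Qed.

(** The superlevel sets [above w] are nonempty and totally ordered by inclusion, so they generate a
    proper filter, which clusters at some [z] in [K]. If [f z < f w], then [f] would stay below
    [f w] on [K] near [z], where [above w] has points. *)
Lemma usc_attains_max (T : topologicalType) (R : realType) (K : set T)
    (f : T -> R) :
  compact K -> K !=set0 ->
  (forall z, K z -> forall a, f z < a -> \forall w \near within K (nbhs z), f w < a) ->
  exists2 z, K z & forall w, K w -> f w <= f z.
Proof.
move=> cK [x0 Kx0] usc_f.
pose above w := [set z | K z /\ f w <= f z].
have FP : ProperFilter (filter_from K above).
  apply: filter_from_proper => [|w Kw]; last by exists w.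
  apply: filter_from_filter; first by exists x0.
  move=> i j Ki Kj; have [ij|/ltW ji] := leP (f i) (f j).
    by exists j => // z [Kz jz]; split; split=> //; exact: le_trans jz.
  by exists i => // z [Kz iz]; split; split=> //; exact: le_trans iz.
have [|z [Kz clz]] := cK _ FP; first by exists x0 => // z [].
exists z => // w Kw; rewrite leNgt; apply/negP => /(usc_f _ Kz) near_lt.
have Fw : filter_from K above (above w) by exists w.
have [y [[Ky wy] yw]] := clz _ _ Fw near_lt.
by have := yw Ky; rewrite ltNge wy.
Qed.

Lemma normc_le (R : rcfType) (x y : R) : normc (x +i* y) <= `|x| + `|y|.
Proof.
rewrite -(@ler_pXn2r _ 2) ?nnegrE ?normc_ge0 ?addr_ge0//.
rewrite sqr_normc_ReIm/= sqrrD !real_normK ?num_real//.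
by rewrite addrAC lerDl mulrn_wge0// mulr_ge0.
Qed.

Lemma normc_continuous (R : realType) : continuous (@normc R).
Proof.
move=> z A /nbhs_ballP[e e0 zA]; apply/nbhs_normcP; exists e => // w wz.
apply: zA; rewrite -ball_normE/=; apply: le_lt_trans wz.
rewrite ler_norml; apply/andP; split.
  have := @le_normcD R (w - z) z; rewrite subrK; lra.
have := @le_normcD R (z - w) w; rewrite subrK -[normc (z - w)]normcN opprB; lra.
Qed.

Lemma complex_pair_continuous (R : realType) :
  continuous (fun p : R * R => p.1 +i* p.2 : R[i]).
Proof.
move=> p A /nbhs_normcP[e e0 pA]; apply/nbhs_ballP; exists (e / 2) => /=.
  by rewrite divr_gt0.
move=> q [/=]; rewrite -!ball_normE/= => q1 q2; apply: pA.
apply: le_lt_trans (normc_le _ _) _.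
by rewrite distrC [X in _ + X]distrC (splitr e) ltrD.
Qed.

(** The annulus is closed and lies in the image of a compact square under the continuous map
    [(x, y) |-> x +i* y]. *)
Lemma compact_annulus (R : realType) (a b : R) :
  compact [set z : R[i] | a <= normc z <= b].
Proof.
pose square := `[- b, b]%classic `*` `[- b, b]%classic.
apply: (@subclosed_compact _ _ ((fun p : R * R => p.1 +i* p.2 : R[i]) @` square)).
- have -> : [set z : R[i] | a <= normc z <= b] = @normc R @^-1` `[a, b].
    by apply/seteqP; split=> z /=; rewrite in_itv.
  by apply: closed_comp; [move=> z _; exact: normc_continuous|exact: itv_closed].
- apply: continuous_compact.
    exact/continuous_subspaceT/complex_pair_continuous.
  by apply: compact_setX; exact: segment_compact.
move=> [x y] /= /andP[_ zb]; exists (x, y) => //.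
have zb2 : x ^+ 2 + y ^+ 2 <= b ^+ 2.
  have := sqr_normc_ReIm (x +i* y); have := normc_ge0 (x +i* y).
  rewrite /= in zb *; nra.
have b0 : 0 <= b := le_trans (normc_ge0 (x +i* y)) zb.
by split; rewrite /= in_itv/= -ler_norml -(@ler_pXn2r _ 2) ?nnegrE//
  real_normK ?num_real//; nra.
Qed.

(** * One-sided Taylor bound of second order *)

(** Near [x] the difference quotient is below [c]; multiplying by [(y - x) ^+ 2] covers both sides
    of [x] with a single inequality. *)
Lemma is_derive_slope_lt (R : realType) (f : R -> R) (x d c : R) :
  is_derive x 1 f d -> d < c ->
  \forall y \near x, (f y - f x - c * (y - x)) * (y - x) <= 0.
Proof.
move=> [fd fdE] dc.
have slope : h^-1 *: (f (h *: 1 + x) - f x) @[h --> 0^'] --> d.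
  by rewrite -fdE; exact: fd.
have [e /= e0 he] := (iffLR (@nbhs_ballP _ _ _ _)) (cvgr_lt _ slope _ dc).
apply/nbhs_ballP; exists e => // y; rewrite -ball_normE/= => xy.
have [->|yx] := eqVneq y x; first by rewrite !subrr mulr0.
have := he (y - x); rewrite -ball_normE/= sub0r normrN distrC => /(_ xy).
rewrite subr_eq0 => /(_ yx); rewrite /GRing.scale/= mulr1 subrK => q.
have : (f y - f x) * (y - x) <= c * (y - x) ^+ 2; last by nra.
have yx2 : 0 < (y - x) ^+ 2 by rewrite exprn_even_gt0//= subr_eq0.
rewrite -ler_pdivrMr//; apply: le_trans (ltW q).
by rewrite expr2 invfM mulrA mulfK ?subr_eq0// mulrC.
Qed.

(** Subtracting the linear term and [c / 2 * (y - x) ^+ 2] leaves [g], whose derivative has sign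
    opposite to [y - x] (weakly), by the slope bound applied to [f']. By the mean value theorem [g]
    then has a local maximum at [x]. *)
Lemma second_order_le (R : realType) (f f' : R -> R) (x d c : R) :
  (\forall y \near x, is_derive (y : R) 1 f (f' y)) -> is_derive x 1 f' d -> d < c ->
  \forall y \near x, f y <= f x + f' x * (y - x) + c / 2 * (y - x) ^+ 2.
Proof.
move=> ff' f'd dc.
have [e /= e0 he] := (iffLR (@nbhs_ballP _ _ _ _))
  (filterI ff' (is_derive_slope_lt f'd dc)).
pose g y := f y - f' x * y - c / 2 * (y - x) ^+ 2.
pose g' y := f' y - f' x - c * (y - x).
have gg' y : `|x - y| < e -> is_derive y 1 g (g' y).
  move=> xy; have [|fy _] := he y; first by rewrite -ball_normE.
  by apply: is_derive_eq; rewrite /g' /GRing.scale/=; field.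
have g'le y : `|x - y| < e -> g' y * (y - x) <= 0.
  by move=> xy; have [|_] := he y; first by rewrite -ball_normE.
have gle a b : a < b -> `|x - a| < e -> `|x - b| < e ->
    exists2 y, y \in `]a, b[ & g b - g a = g' y * (b - a).
  move=> ab xa xb; apply: MVT => // [y|].
    rewrite in_itv/= => /andP[ay yb]; apply: gg'.
    by rewrite ltr_norml; move: xa xb; rewrite !ltr_norml; lra.
  apply: derivable_within_continuous => y; rewrite in_itv/= => /andP[ay yb].
  have [] // := gg' y.
  by move: xa xb; rewrite !ltr_norml; lra.
apply/nbhs_ballP; exists e => // y; rewrite -ball_normE/= => xy.
suff : g y <= g x by rewrite /g subrr expr0n/= mulr0; lra.
have xx : `|x - x| < e by rewrite subrr normr0.
have [xlty|yltx|->//] := ltgtP x y.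
  have [w] := gle _ _ xlty xx xy; rewrite in_itv/= => /andP[xw wy] gE.
  have xwe : `|x - w| < e by move: xy; rewrite !ltr_norml; lra.
  have : g' w <= 0 by have := g'le _ xwe; nra.
  nra.
have [w] := gle _ _ yltx xy xx; rewrite in_itv/= => /andP[yw wx] gE.
have xwe : `|x - w| < e by move: xy; rewrite !ltr_norml; lra.
have : 0 <= g' w by have := g'le _ xwe; nra.
nra.
Qed.

(** * Circle means and the Laplacian of radial functions *)

(** [F] is an explicit antiderivative; its trigonometric terms are periodic, so only the terms
    linear in [t] contribute. *)
Lemma integral_trig_quadratic (R : realType) (A B C x y : R) :
  (\int[@lebesgue_measure R]_(t in `[0%R, (2 * pi)%R])
     (A + B * (x * cos t + y * sin t) + C * (x * cos t + y * sin t) ^+ 2)%:E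
   = (2 * pi * (A + C * (x ^+ 2 + y ^+ 2) / 2))%:E)%E.
Proof.
pose f t : R := A + B * (x * cos t + y * sin t) + C * (x * cos t + y * sin t) ^+ 2.
pose F t : R := A * t + B * (x * sin t - y * cos t) +
  C * ((x ^+ 2 + y ^+ 2) / 2 * t + (x ^+ 2 - y ^+ 2) / 2 * (sin t * cos t)
       + x * y * sin t ^+ 2).
have FE (t : R) : is_derive t 1 F (f t).
  apply: is_derive_eq; rewrite /f /GRing.scale/=.
  apply/eqP; rewrite -subr_eq0; apply/eqP.
  transitivity (C * (x ^+ 2 + y ^+ 2) / 2 * (1 - (cos t ^+ 2 + sin t ^+ 2))).
    by field.
  by rewrite cos2Dsin2 subrr mulr0.
have Fc : continuous F.
  by move=> t; apply/differentiable_continuous/derivable1_diffP; case: (FE t).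
have fc : continuous f.
  move=> t; apply/differentiable_continuous/derivable1_diffP.
  exact: ex_derive.
have pi2 : 0 < 2 * pi :> R by rewrite mulr_gt0 ?pi_gt0.
rewrite (@continuous_FTC2 _ f F)//.
- rewrite /F mulr_natl cos2pi sin2pi cos0 sin0 -EFinB; congr EFin.
  ring.
- exact: continuous_subspaceT.
- split=> [t _||]; first by case: (FE t).
    by apply: cvg_at_right_filter; exact: Fc.
  by apply: cvg_at_left_filter; exact: Fc.
by move=> t _; rewrite derive1E; case: (FE t).
Qed.

(** A quadratic in [x * cos t + y * sin t] is what a second-order Taylor bound in the squared
    modulus becomes on a circle around [x +i* y]. *)
Lemma log_circle_mean_le (R : realType) (lambda : R[i] -> R) (x y r A B C : R) :
  (forall t, ln (lambda ((x +i* y) + (r * cos t +i* (r * sin t)))) <=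
     A + B * (x * cos t + y * sin t) + C * (x * cos t + y * sin t) ^+ 2) ->
  (log_circle_mean lambda (x +i* y) r <= (A + C * (x ^+ 2 + y ^+ 2) / 2)%:E)%E.
Proof.
move=> le_quad; rewrite /log_circle_mean.
have pi2 : 0 < 2 * pi :> R by rewrite mulr_gt0 ?pi_gt0.
apply: (@le_trans _ _ (((2 * pi)^-1)%:E *
    (2 * pi * (A + C * (x ^+ 2 + y ^+ 2) / 2))%:E)%E); last first.
  by rewrite -EFinM mulKf// gt_eqF.
apply: lee_wpmul2l; first by rewrite lee_fin invr_ge0 ltW.
rewrite -(integral_trig_quadratic A B C x y).
by apply: le_integral_pointwise => t _; rewrite lee_fin.
Qed.

(** Inserting the Taylor bound of [f] at [s] into the circle mean gives at most
    [4 * f' s + 4 * s * c + 2 * c * r ^+ 2] for all small [r], with [c] slightly above [d]. Each of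
    the two errors takes half of [e]. *)
Lemma laplacian_touching_le (R : realType) (lambda : R[i] -> R) (z : R[i])
    (f f' : R -> R) (d e : R) :
  (\forall s \near normc z ^+ 2, is_derive (s : R) 1 f (f' s)) ->
  is_derive (normc z ^+ 2) 1 f' d ->
  (\forall w \near z,
     ln (lambda w) - ln (lambda z) <= f (normc w ^+ 2) - f (normc z ^+ 2)) ->
  0 < e ->
  (limf_einf (fun r : R =>
     (4 / r ^+ 2)%:E * (log_circle_mean lambda z r - (ln (lambda z))%:E))
     0%R^'+ <= (4 * (f' (normc z ^+ 2) + normc z ^+ 2 * d) + e)%:E)%E.
Proof.
move=> ff' f'd touch e0; set s := normc z ^+ 2 in ff' f'd touch *.
have s0 : 0 <= s by rewrite /s sqr_ge0.
(* The excess over [d] costs [4 * s * (c - d) <= e / 2]; the [+ 1] keeps the denominator positive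
   when [s = 0]. *)
pose c := d + e / (8 * (s + 1)).
have s1 : 0 < 8 * (s + 1) by lra.
have dc : d < c by rewrite ltrDl divr_gt0.
have sc : 4 * s * c <= 4 * s * d + e / 2.
  rewrite /c mulrDr lerD2l mulrA ler_pdivrMr//; nra.
have taylor := second_order_le ff' f'd dc.
have sqr_normc_cvg : normc w ^+ 2 @[w --> z] --> s.
  have normc_cvg : normc w @[w --> z] --> normc z by exact: normc_continuous.
  exact: (cvgM normc_cvg normc_cvg).
have [e1 e10 near_z] := (iffLR (nbhs_normcP _ _))
  (filterI touch (sqr_normc_cvg _ taylor)).
apply: limf_einf_le.
near=> r.
have r0 : 0 < r by near: r; exact: nbhs_right_gt.
have re1 : r < e1 by near: r; exact: nbhs_right_lt.
have r1 : r < 1 by near: r; exact: nbhs_right_lt.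
(* Together with [r < 1] this bounds the remainder [2 * c * r ^+ 2] by [e / 2]. *)
have rc : r < e / (4 * `|c| + 1).
  by near: r; apply: nbhs_right_lt; rewrite divr_gt0// ltr_wpDl// mulr_ge0.
have cr : 4 * c * r ^+ 2 <= e.
  move: rc; rewrite ltr_pdivlMr ?ltr_wpDl ?mulr_ge0// => rc.
  have := ler_norm c; have := normr_ge0 c; nra.
have -> : z = complex.Re z +i* complex.Im z by case: (z).
have sE : s = complex.Re z ^+ 2 + complex.Im z ^+ 2 by exact: sqr_normc_ReIm.
set x := complex.Re z in sE *; set y := complex.Im z in sE *.
have zE : z = x +i* y by rewrite /x /y; case: (z).
(* The coefficients come from expanding the Taylor bound at [s + r ^+ 2 + 2 * r * u] in powers of
   [u = x * cos t + y * sin t]. *)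
have mean_le : (log_circle_mean lambda (x +i* y) r <=
    (ln (lambda z) + f' s * r ^+ 2 + c / 2 * r ^+ 4 + 2 * c * r ^+ 2 *
      (x ^+ 2 + y ^+ 2) / 2)%:E)%E.
  apply: (@log_circle_mean_le _ _ _ _ _ _ (2 * f' s * r + 2 * c * r ^+ 3)) => t.
  set w := _ + _.
  have wE : normc w ^+ 2 - s = r ^+ 2 + 2 * r * (x * cos t + y * sin t).
    rewrite sqr_normc_ReIm sE/=.
    have : r ^+ 2 * (cos t ^+ 2 + sin t ^+ 2) = r ^+ 2 by rewrite cos2Dsin2 mulr1.
    nra.
  have [|w_touch w_taylor] := near_z w.
    rewrite /w zE addrC addKr -(@ltr_pXn2r _ 2) ?nnegrE ?normc_ge0 ?ltW//.
    rewrite sqr_normc_ReIm/=.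
    have : r ^+ 2 * (cos t ^+ 2 + sin t ^+ 2) = r ^+ 2 by rewrite cos2Dsin2 mulr1.
    nra.
  move: w_touch w_taylor => /=; rewrite wE; set u := _ + y * sin t => ? ?.
  have -> : ln (lambda z) + f' s * r ^+ 2 + c / 2 * r ^+ 4 +
      (2 * f' s * r + 2 * c * r ^+ 3) * u + 2 * c * r ^+ 2 * u ^+ 2 =
      ln (lambda z) + f' s * (r ^+ 2 + 2 * r * u) + c / 2 * (r ^+ 2 + 2 * r * u) ^+ 2.
    by field.
  by lra.
rewrite -zE; rewrite -zE in mean_le.
apply: (@le_trans _ _ ((4 / r ^+ 2)%:E * (f' s * r ^+ 2 + c / 2 * r ^+ 4 +
    c * r ^+ 2 * s)%:E)%E).
  apply: lee_wpmul2l; first by rewrite lee_fin divr_ge0// sqr_ge0.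
  rewrite leeBlDr//; apply: le_trans mean_le _.
  by rewrite -EFinD lee_fin sE; lra.
rewrite -EFinM lee_fin.
have -> : 4 / r ^+ 2 * (f' s * r ^+ 2 + c / 2 * r ^+ 4 + c * r ^+ 2 * s) =
    4 * f' s + 2 * c * r ^+ 2 + 4 * s * c by field; rewrite gt_eqF.
lra.
Unshelve. all: by end_near. Qed.

(** The curvature bound makes the lower limit at least [4 * lambda z ^+ 2], while touching from
    above bounds it by the Laplacian of the radial function [f (normc w ^+ 2)] at [z]. *)
Lemma SK_touching_le (R : realType) (lambda : R[i] -> R) (z : R[i])
    (f f' : R -> R) (d : R) :
  0 < lambda z -> (curvature lambda z <= (- 4%R)%:E)%E ->
  (\forall s \near normc z ^+ 2, is_derive (s : R) 1 f (f' s)) ->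
  is_derive (normc z ^+ 2) 1 f' d ->
  (\forall w \near z,
     ln (lambda w) - ln (lambda z) <= f (normc w ^+ 2) - f (normc z ^+ 2)) ->
  lambda z ^+ 2 <= f' (normc z ^+ 2) + normc z ^+ 2 * d.
Proof.
move=> l0 curv ff' f'd touch; apply/ler_addgt0Pr => e e0.
have e4 : 0 < 4 * e by rewrite mulr_gt0.
have := laplacian_touching_le ff' f'd touch e4.
move: curv; rewrite /curvature; set L := limf_einf _ _ => curv Lle.
set M := 4 * _ + _ in Lle.
have l2 : 0 < lambda z ^+ 2 by rewrite exprn_gt0.
have il2 : 0 < (lambda z ^+ 2)^-1 by rewrite invr_gt0.
suff : 4 * lambda z ^+ 2 <= M by rewrite /M; lra.
have : (((lambda z ^+ 2)^-1)%:E * L <= ((lambda z ^+ 2)^-1 * M)%:E)%E.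
  by rewrite EFinM; apply: lee_wpmul2l => //; rewrite lee_fin ltW.
rewrite -leeN2 => h; have := le_trans h; rewrite -mulNe => /(_ _ curv).
rewrite -EFinN lee_fin lerN2 mulrC ler_pdivlMr//.
Qed.

(** * The comparison metric and its curvature *)

(* With [k = R^b], the density [mu] of the header is
   [mu z = b * k / barrier b k (normc z ^+ 2)]. *)
Definition barrier (R : realType) (b k s : R) : R :=
  expR ((1 - b) / 2 * ln s) * (k ^+ 2 - expR (b * ln s)).

Lemma barrier_continuous (R : realType) (b k s : R) : 0 < s ->
  {for s, continuous (barrier b k)}.
Proof.
move=> s0; apply/differentiable_continuous/derivable1_diffP.
have ln_derive := is_derive1_ln s0.
exact: ex_derive.
Qed.

(** For positive [b] and [k], [- ln (barrier b k s)] is [ln mu] up to an additive constant, hence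
    the function to touch [ln lambda] with. *)
Lemma is_derive_neg_ln_barrier (R : realType) (b k s : R) :
  0 < s -> expR (b * ln s) < k ^+ 2 ->
  is_derive s 1 (fun s => - ln (barrier b k s))
    ((b * expR (b * ln s) / (k ^+ 2 - expR (b * ln s)) - (1 - b) / 2) / s).
Proof.
move=> s0 sk.
have ln_derive := is_derive1_ln s0.
have bpos : 0 < barrier b k s by rewrite mulr_gt0 ?expR_gt0// subr_gt0.
have ln_barrier_derive := is_derive1_ln bpos.
apply: is_derive_eq; rewrite /barrier /GRing.scale/=; field.
by rewrite !gt_eqF ?expR_gt0 ?subr_gt0.
Qed.

(** In this form [f'] cancels from [f' + s * f''], leaving [b ^+ 2 * k ^+ 2 * E / (s * (k ^+ 2 - E)
    ^+ 2)] with [E = expR (b * ln s)]. This is [mu ^+ 2]: the curvature of [mu] is -4. *)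
Lemma is_derive_neg_ln_barrier_derive (R : realType) (b k s : R) :
  0 < s -> expR (b * ln s) < k ^+ 2 ->
  is_derive s 1
    (fun s => (b * expR (b * ln s) / (k ^+ 2 - expR (b * ln s)) - (1 - b) / 2) / s)
    ((b ^+ 2 * k ^+ 2 * expR (b * ln s) / (k ^+ 2 - expR (b * ln s)) ^+ 2
       - (b * expR (b * ln s) / (k ^+ 2 - expR (b * ln s)) - (1 - b) / 2)) / s ^+ 2).
Proof.
move=> s0 sk.
have ln_derive := is_derive1_ln s0.
have sn0 : s != 0 by rewrite gt_eqF.
pose E t : R := expR (b * ln t).
have E_derive : is_derive s 1 E (b * E s / s).
  by apply: is_derive_eq; rewrite /GRing.scale/= mulrCA mulrA.
have Q_derive : is_derive s 1 (fun t => k ^+ 2 - E t) (- (b * E s / s)).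
  by apply: is_derive_eq; rewrite /GRing.scale/=; ring.
have Qn0 : k ^+ 2 - E s != 0 by rewrite gt_eqF// subr_gt0.
have QV_derive := is_deriveV (f := fun t => k ^+ 2 - E t) Qn0 Q_derive.
have V_derive := is_deriveV (f := fun t : R => t) sn0 (is_derive_id s 1).
have C_derive := is_derive_cst ((1 - b) / 2 : R) (s : R) 1.
have bE_derive : is_derive s 1 (fun t => b * E t) (b * (b * E s / s)).
  by apply: is_derive_eq.
have := is_deriveM (is_deriveB (is_deriveM bE_derive QV_derive) C_derive) V_derive.
move=> H; apply: (is_derive_eq H).
rewrite !fctE /GRing.scale/= /E; set e := expR _ in Qn0 *.
by field; rewrite sn0 Qn0.
Qed.

Lemma ln_sub_le (R : realType) (a b c d : R) :
  0 < a -> 0 < b -> 0 < c -> 0 < d -> a * b <= c * d -> ln a - ln c <= ln d - ln b.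
Proof.
move=> a0 b0 c0 d0; rewrite -ler_ln ?posrE ?mulr_gt0// !lnM ?posrE//; lra.
Qed.

(** The product [lambda * barrier] is [b * k] times [lambda / mu]. At a local maximum of it, [ln mu]
    touches [ln lambda] from above up to a constant, which yields [lambda z ^+ 2 <= mu z ^+ 2]. *)
Lemma SK_local_max_le (R : realType) (lambda : R[i] -> R) (b k : R) (z : R[i]) :
  0 < b -> 0 < k -> 0 < normc z -> expR (b * ln (normc z ^+ 2)) < k ^+ 2 ->
  0 < lambda z -> (curvature lambda z <= (- 4%R)%:E)%E ->
  (\forall w \near z, 0 < lambda w /\
     lambda w * barrier b k (normc w ^+ 2) <= lambda z * barrier b k (normc z ^+ 2)) ->
  lambda z * barrier b k (normc z ^+ 2) <= b * k.
Proof.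
move=> b0 k0 z0 zk lz curv zmax; set s := normc z ^+ 2 in zk zmax *.
have s0 : 0 < s by rewrite exprn_gt0.
have lnE_cts : {for s, continuous (fun s => expR (b * ln s))}.
  have ln_derive := is_derive1_ln s0.
  apply/differentiable_continuous/derivable1_diffP; exact: ex_derive.
have near_s : \forall t \near s, 0 < t /\ expR (b * ln t) < k ^+ 2.
  apply: filterI; first exact: lt_nbhsr.
  exact: (cvgr_lt _ lnE_cts).
have barrier_gt0 t : 0 < t /\ expR (b * ln t) < k ^+ 2 -> 0 < barrier b k t.
  by move=> [_ tk]; rewrite mulr_gt0 ?expR_gt0// subr_gt0.
have bs := barrier_gt0 _ (conj s0 zk).
have sqr_normc_cvg : normc w ^+ 2 @[w --> z] --> s.
  have normc_cvg : normc w @[w --> z] --> normc z by exact: normc_continuous.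
  exact: (cvgM normc_cvg normc_cvg).
have := @SK_touching_le _ lambda z (fun s => - ln (barrier b k s)) _ _ lz curv _
  (is_derive_neg_ln_barrier_derive s0 zk).
have near_derive : \forall t \near s, is_derive (t : R) 1 (fun s => - ln (barrier b k s))
    ((b * expR (b * ln t) / (k ^+ 2 - expR (b * ln t)) - (1 - b) / 2) / t).
  by apply: filterS near_s => t [t0 tk]; exact: is_derive_neg_ln_barrier.
move=> /(_ near_derive); rewrite -/s => touching_le.
have {}touching_le : lambda z ^+ 2 <=
    b ^+ 2 * k ^+ 2 * expR (b * ln s) / (s * (k ^+ 2 - expR (b * ln s)) ^+ 2).
  apply: le_trans (touching_le _) _.
    apply: filterS (filterI zmax (sqr_normc_cvg _ near_s)).
    move=> w [[lw wz] /barrier_gt0 bw].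
    by rewrite opprK [leRHS]addrC; apply: ln_sub_le.
  set e := expR _; rewrite le_eqVlt; apply/orP; left; apply/eqP; field.
  by rewrite subr_eq0 !gt_eqF.
(* This identity turns the right-hand side of [touching_le] into
   [(b * k) ^+ 2 / barrier b k s ^+ 2]. *)
have bsE : barrier b k s ^+ 2 * expR (b * ln s) = s * (k ^+ 2 - expR (b * ln s)) ^+ 2.
  rewrite /barrier exprMn mulrAC; congr (_ * _).
  by rewrite expr2 -!expRD -[RHS]lnK ?posrE//; congr expR; field.
have lb0 : 0 <= lambda z * barrier b k s by rewrite mulr_ge0// ltW.
have bk0 : 0 <= b * k by rewrite mulr_ge0// ltW.
rewrite -(@ler_pXn2r _ 2) ?nnegrE// [leLHS]exprMn [leRHS]exprMn.
rewrite -ler_pdivlMr ?exprn_gt0//; apply: le_trans touching_le _.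
by rewrite -bsE -mulf_div divff ?mulr1// gt_eqF ?expR_gt0.
Qed.

(** * Maximum principle on the punctured disc *)

Lemma usc_mul_continuous (T : topologicalType) (R : realType) (K : set T)
    (f h : T -> R) (z : T) (a : R) :
  (forall w, K w -> 0 <= f w) -> (forall w, K w -> 0 <= h w) -> K z ->
  (forall a, f z < a -> \forall w \near within K (nbhs z), f w < a) ->
  {for z, continuous h} -> f z * h z < a ->
  \forall w \near within K (nbhs z), f w * h w < a.
Proof.
move=> f0 h0 Kz usc_f hz fha.
have fz := f0 _ Kz; have hz0 := h0 _ Kz.
have den : 0 < f z + h z + 2 by lra.
(* Since [e <= 1], [(f z + e) * (h z + e)] is at most [f z * h z + e * (f z + h z + 1)], which stays
   below [a]. *)
pose e := Num.min 1 ((a - f z * h z) / (f z + h z + 2)).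
have e0 : 0 < e by rewrite lt_min ltr01 divr_gt0// subr_gt0.
have e1 : e <= 1 by rewrite ge_min lexx.
have ea : e * (f z + h z + 2) <= a - f z * h z.
  by rewrite -ler_pdivlMr// ge_min lexx orbT.
have near_f : \forall w \near z, K w -> f w < f z + e.
  by apply: usc_f; rewrite ltrDl.
have near_h : \forall w \near z, h w < h z + e.
  by apply: (cvgr_lt _ hz); rewrite ltrDl.
suff : \forall w \near z, K w -> f w * h w < a by [].
apply: filterS (filterI near_f near_h) => w [fw hw] Kw.
have := fw Kw; have := f0 _ Kw; have := h0 _ Kw; nra.
Qed.

(** This half of the two-sided estimate is what makes [lambda / mu] small near the origin. *)
Lemma singularity_upper_bound (R : realType) (lambda : R[i] -> R) (alpha : R) :
  singularity_of_order lambda alpha ->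
  exists C, exists2 e, 0 < e &
    forall w, 0 < normc w < e -> ln (lambda w) <= - alpha * ln (normc w) + C.
Proof.
move=> [_ /eqaddOP/pinfty_ex_gt0[C C0 near_C]].
have [e e0 he] := iffLR (nbhs_normcP _ _) near_C.
exists C, e => // w /andP[w0 we].
have := he w; rewrite subr0 => /(_ we); rewrite -normc_gt0 => /(_ w0).
rewrite normr1 mulr1 => /(le_trans (ler_norm _)).
by rewrite !fctE; lra.
Qed.

Lemma SK_barrier_le (R : realType) (lambda : R[i] -> R) (alpha b k : R)
    (z : R[i]) :
  SK_metric (punctured_disc R) lambda -> singularity_of_order lambda alpha ->
  0 < b -> b < 1 - alpha -> 0 < k -> k < 1 -> 0 < normc z < 1 ->
  lambda z * barrier b k (normc z ^+ 2) <= b * k.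
Proof.
move=> [[lambda_gt0 lambda_usc] curv] sing b0 ba k0 k1 z01.
have z0 : 0 < normc z by case/andP: z01.
have [C [e e0 near0]] := singularity_upper_bound sing.
rewrite leNgt; apply/negP => bkz.
(* The radius whose [b]-th power is [k]: there the barrier vanishes. *)
pose radius := expR (ln k / b).
have radius1 : radius < 1.
  by rewrite -expR0 ltr_expR ltr_pdivrMr// mul0r ln_lt0// k0.
have lnX2 r : 0 < r -> ln (r ^+ 2) = 2 * ln r :> R.
  by move=> r0; rewrite lnXn// mulr_natl.
have k2E : k ^+ 2 = expR (2 * ln k) by rewrite -lnX2// lnK// posrE exprn_gt0.
have E_radius r : 0 < r -> (expR (b * ln (r ^+ 2)) <= k ^+ 2) = (r <= radius).
  move=> r0; rewrite lnX2// k2E ler_expR mulrCA ler_pM2l// mulrC -ler_pdivlMr//.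
  by rewrite -[in RHS](lnK r0) ler_expR.
have barrier_ge0 r : 0 < r <= radius -> 0 <= barrier b k (r ^+ 2).
  move=> /andP[r0]; rewrite -E_radius// => rk.
  by rewrite mulr_ge0 ?expR_ge0// subr_ge0.
have barrier_gt0 r : 0 < r -> 0 < barrier b k (r ^+ 2) ->
    expR (b * ln (r ^+ 2)) < k ^+ 2 /\ r < radius.
  move=> r0; rewrite pmulr_rgt0 ?expR_gt0// subr_gt0 => rk; split=> //.
  by rewrite lt_neqAle -E_radius// (ltW rk) andbT; apply: contraTneq rk => ->;
    rewrite lnX2 ?expR_gt0// expRK mulrCA [b * _]mulrC divfK ?gt_eqF// k2E ltxx.
have lz : 0 < lambda z by exact: lambda_gt0.
have bk0 : 0 < b * k by rewrite mulr_gt0.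
have z_radius : normc z < radius.
  have : 0 < lambda z * barrier b k (normc z ^+ 2) by exact: lt_trans bkz.
  by rewrite pmulr_rgt0// => /(barrier_gt0 _ z0)[].
pose rho := Num.min (normc z) (Num.min (e / 2)
  (expR ((ln (b / k) - C) / (1 - alpha - b)))).
have rho0 : 0 < rho by rewrite !lt_min z0 divr_gt0//= expR_gt0.
have rhoz : rho <= normc z by rewrite ge_min lexx.
have rhoe : rho < e.
  by apply: (@le_lt_trans _ _ (e / 2)); [rewrite !ge_min lexx orbT|lra].
have small w : 0 < normc w <= rho -> lambda w * barrier b k (normc w ^+ 2) <= b * k.
  move=> /andP[w0 wrho].
  have wradius : normc w <= radius by rewrite (le_trans wrho)// (le_trans rhoz)// ltW.
  have w1 : normc w < 1 by apply: le_lt_trans wrho (le_lt_trans rhoz _); case/andP: z01.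
  have lw : 0 < lambda w by apply: lambda_gt0; rewrite /punctured_disc/= w0.
  have lnw : (1 - alpha - b) * ln (normc w) <= ln (b / k) - C.
    rewrite mulrC -ler_pdivlMr ?subr_gt0// -ler_expR lnK//.
    by apply: le_trans wrho _; rewrite !ge_min lexx !orbT.
  have /near0 lambda_le : 0 < normc w < e by rewrite w0 (le_lt_trans wrho).
  (* Splitting [b * k] as [(b / k) * k ^+ 2] matches the two factors of the barrier, so each can be
     bounded separately. *)
  have -> : b * k = expR (ln (b / k)) * k ^+ 2.
    by rewrite lnK ?posrE ?divr_gt0// expr2 mulrA divfK// gt_eqF.
  rewrite -[lambda w]lnK ?posrE// /barrier mulrA -expRD; apply: ler_pM => //.
  - by rewrite subr_ge0 E_radius.
  - by rewrite ler_expR lnX2//; nra.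
  - by rewrite gerBl expR_ge0.
pose K : set R[i] := [set w | rho <= normc w <= radius].
have K_disc w : K w -> 0 < normc w < 1.
  by move=> /andP[? ?]; rewrite (lt_le_trans rho0)//= (le_lt_trans _ radius1).
pose h (w : R[i]) := barrier b k (normc w ^+ 2).
have h_continuous w : 0 < normc w -> {for w, continuous h}.
  move=> w0; apply: continuous_comp; last first.
    by apply: barrier_continuous; rewrite exprn_gt0.
  have normc_cvg : normc v @[v --> w] --> normc w by exact: normc_continuous.
  exact: (cvgM normc_cvg normc_cvg).
have [||z1 Kz1 z1_max] := usc_attains_max (f := fun w => lambda w * h w)
    (@compact_annulus R rho radius).
- by exists z; rewrite /= rhoz ltW.
- move=> w Kw a lwa; have /andP[w0 w1] := K_disc _ Kw.
  apply: usc_mul_continuous => //.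
  + by move=> v /K_disc/lambda_gt0/ltW.
  + move=> v Kv; apply: barrier_ge0; have /andP[-> _] := K_disc _ Kv.
    by case/andP: Kv.
  + move=> c lwc; suff : \forall v \near w, K v -> lambda v < c by [].
    have : \forall v \near w, punctured_disc R v -> lambda v < c.
      exact: lambda_usc (K_disc _ Kw) _ lwc.
    by apply: filterS => v lvc /K_disc/lvc.
  + exact: h_continuous.
have /andP[z10 z11] := K_disc _ Kz1.
have lz1 : 0 < lambda z1 by apply: lambda_gt0; rewrite /punctured_disc/= z10.
have z1_big : b * k < lambda z1 * h z1.
  by apply: lt_le_trans bkz _; apply: z1_max; rewrite /= rhoz ltW.
(* The maximiser is interior: a positive barrier excludes the outer circle, and [small] excludes the
   inner one. *)
have [z1E z1_radius] : expR (b * ln (normc z1 ^+ 2)) < k ^+ 2 /\ normc z1 < radius.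
  by apply: barrier_gt0 => //; rewrite -(pmulr_rgt0 _ lz1) (lt_trans bk0).
have z1_rho : rho < normc z1.
  by rewrite ltNge; apply/negP => z1r; move: z1_big; rewrite ltNge small ?z10.
move: z1_big; rewrite ltNge => /negP; apply.
apply: SK_local_max_le => //; first by apply: curv; rewrite /punctured_disc/= z10.
have normc_cvg : normc w @[w --> z1] --> normc z1 by exact: normc_continuous.
apply: filterS (filterI (cvgr_gt _ normc_cvg _ z1_rho) (cvgr_lt _ normc_cvg _ z1_radius)).
move=> w [rw wr]; have Kw : K w by rewrite /K/= !ltW.
by split; [exact/lambda_gt0/K_disc|exact: z1_max].
Qed.

(** * Passage to the limit in the parameters, and the upper limit at the origin *)

Lemma le_left_limit (R : realType) (f : R -> R) (a b c : R) :
  a < b -> {for b, continuous f} -> (forall x, a < x < b -> f x <= c) -> f b <= c.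
Proof.
move=> ab fb fc; rewrite leNgt; apply/negP => cfb.
have [e /= e0 he] := iffLR (nbhs_ballP _ _) (cvgr_gt _ fb _ cfb).
pose m := Num.min e (b - a).
have m0 : 0 < m by rewrite lt_min e0 subr_gt0.
have me : m <= e by rewrite ge_min lexx.
have mab : m <= b - a by rewrite ge_min lexx orbT.
have : c < f (b - m / 2).
  by apply: he; rewrite -ball_normE/= opprB addrCA subrr addr0 gtr0_norm; lra.
by rewrite ltNge fc//; lra.
Qed.

(** The comparison holds for [k < 1] and [b < 1 - alpha]. Both sides are continuous in each
    parameter, so first [k] tends to 1 with [b] fixed, then [b] tends to [1 - alpha]. *)
Lemma SK_order_le (R : realType) (lambda : R[i] -> R) (alpha : R) (z : R[i]) :
  SK_metric (punctured_disc R) lambda -> singularity_of_order lambda alpha ->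
  0 < normc z < 1 ->
  lambda z * barrier (1 - alpha) 1 (normc z ^+ 2) <= 1 - alpha.
Proof.
move=> SK sing z01; have alpha1 : alpha < 1 by case: sing.
rewrite -subr_le0.
pose f b := lambda z * barrier b 1 (normc z ^+ 2) - b.
have f_cts : continuous f.
  move=> b; apply/differentiable_continuous/derivable1_diffP; exact: ex_derive.
apply: (@le_left_limit _ f 0 (1 - alpha)); [by rewrite subr_gt0|exact: f_cts|].
move=> b /andP[b0 ba].
pose g k := lambda z * barrier b k (normc z ^+ 2) - b * k.
have g_cts : continuous g.
  move=> k; apply/differentiable_continuous/derivable1_diffP; exact: ex_derive.
have -> : f b = g 1 by rewrite /f /g mulr1.
apply: (@le_left_limit _ g 0 1) => //; first exact: g_cts.
move=> k /andP[k0 k1].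
by rewrite subr_le0; apply: (SK_barrier_le SK sing).
Qed.

Theorem theorem4p5 (R : realType) (lambda : R[i] -> R) (alpha : R)
    (alpha_range : 0 < alpha < 1)
    (lambda_SK : SK_metric (punctured_disc R) lambda)
    (lambda_sing : singularity_of_order lambda alpha) :
  (limf_esup (fun z : R[i] => (normc z `^ alpha * lambda z)%:E) (0%R : R[i])^'
    <= (1 - alpha)%:E)%E.
Proof.
have a0 : 0 < 1 - alpha by rewrite subr_gt0; case/andP: alpha_range.
apply/lee_addgt0Pr => e e0; apply: limf_esup_le.
set a := 1 - alpha in a0 *.
(* With this [q], [1 - q = a / (a + e)], so that [P * (1 - q) <= a] amounts to [P <= a + e]. *)
pose q := e / (a + e).
have q0 : 0 < q by rewrite divr_gt0// addr_gt0.
(* The second radius is where the [2 * a]-th power of the modulus equals [q]. *)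
apply/nbhs_normcP; exists (Num.min 1 (expR (ln q / (2 * a)))).
  by rewrite lt_min ltr01 expR_gt0.
move=> z; rewrite subr0 lt_min -normc_gt0 => /andP[z1 zq] z0.
rewrite /= lee_fin.
have z01 : 0 < normc z < 1 by rewrite z0.
have := SK_order_le lambda_SK lambda_sing z01.
have lz : 0 < lambda z by case: lambda_SK => -[lambda_gt0 _] _; exact: lambda_gt0.
rewrite -/a /barrier expr1n.
have lnX2 : ln (normc z ^+ 2) = 2 * ln (normc z) by rewrite lnXn// mulr_natl.
(* As [1 - a = alpha], the first factor of the limiting barrier is exactly the weight in the upper
   limit. *)
have -> : expR ((1 - a) / 2 * ln (normc z ^+ 2)) = normc z `^ alpha.
  by rewrite /powR gt_eqF// lnX2; congr expR; rewrite /a; field.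
rewrite mulrA [lambda z * _]mulrC; set P := _ * lambda z => P_le.
have P0 : 0 <= P by rewrite mulr_ge0 ?powR_ge0 ?ltW.
have Eq : expR (a * ln (normc z ^+ 2)) <= q.
  rewrite -[leRHS]lnK ?posrE// ler_expR lnX2 mulrCA mulrA [leLHS]mulrC.
  have a2 : 0 < 2 * a by rewrite mulr_gt0.
  by rewrite -ler_pdivlMr// -ler_expR lnK ?posrE// ltW.
have : P * (1 - q) <= a by apply: le_trans P_le; apply: ler_wpM2l => //; lra.
have -> : 1 - q = a / (a + e) by rewrite /q; field; rewrite gt_eqF// addr_gt0.
have ae0 : 0 < a + e by exact: addr_gt0.
by rewrite mulrA ler_pdivrMr// [P * a]mulrC ler_pM2l.
Qed.
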